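(* Assume there is a constant $K>0$ such that $a_{j,k}\le Kjk$ for all $j,k\in\mathbb N$, and that $a_{j,j}>0$ for all $j\in\mathbb N$. Let $c$ be a solution of the RBK system with initial condition $c(t_0)=c_0\in X_1^+$, defined on $[t_0,\infty)$. Then, for all $j\in\mathbb N$, $c_j(t)\to0$ as $t\to\infty$.
   Context: The rate coefficients $a_{j,k}$ ($j,k\in\mathbb N=\{1,2,\dots\}$) are real with $a_{j,k}=a_{k,j}\ge 0$. The Redner--Ben-Avraham--Kahng (RBK) system is $$\frac{dc_j}{dt}=\sum_{k=1}^\infty a_{j+k,k}c_{j+k}c_k-\sum_{k=1}^\infty a_{j,k}c_jc_k,\qquad j\in\mathbb N.$$ $X_1=\{x=(x_j)\in\mathbb R^{\mathbb N}: \|x\|_1:=\sum_{j=1}^\infty j|x_j|<\infty\}$ and $X_1^+=\{x\in X_1: x_j\ge 0\ \forall j\}$. Definition (solution). A (mild) solution of the RBK system on $[t_0,\infty)$ with $c(t_0)=c_0\in X_1^+$ is a function $c=(c_j):[t_0,\infty)\to X_1^+$ such that: (i) each $c_j:[t_0,\infty)\to[0,\infty)$ is continuous and $\sup_{t\ge t_0}\|c(t)\|_1<\infty$; (ii) for all $j\in\mathbb N$ and $t\ge t_0$, $\int_{t_0}^t\sum_{k=1}^\infty a_{j,k}c_k(s)\,ds<\infty$; (iii) for all $j\in\mathbb N$ and $t\ge t_0$, $$c_j(t)=c_{0j}+\int_{t_0}^t\Big[\sum_{k=1}^\infty a_{j+k,k}c_{j+k}(s)c_k(s)-\sum_{k=1}^\infty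 a_{j,k}c_j(s)c_k(s)\Big]ds.$$ *)

(* Defs.v *)
From HB Require Import structures.
From mathcomp Require Import all_boot all_order all_algebra.
From mathcomp Require Import all_classical all_reals all_analysis.
Import Order.TTheory GRing.Theory Num.Theory.
Import numFieldNormedType.Exports.

Set Implicit Arguments.
Unset Strict Implicit.
Unset Printing Implicit Defensive.

Local Open Scope classical_set_scope.
Local Open Scope ring_scope.

(* Sequences indexed by {1, 2, ...} are functions on nat whose value at 0 is
   irrelevant: every sum starts at 1 and every quantifier over indices is
   restricted to positive ones. Infinite sums and Lebesgue integrals are taken
   in \bar R, so that "< +oo" expresses convergence. *)

Definition norm1 (R : realType) (x : nat -> R) : \bar R :=
  (\sum_(1 <= j <oo) (j%:R * `|x j|)%:E)%E.

Definition X1 (R : realType) : set (nat -> R) :=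
  [set x | (norm1 x < +oo)%E].

Definition X1pos (R : realType) : set (nat -> R) :=
  X1 (R := R) `&` [set x | forall j, (0 < j)%N -> 0 <= x j].

Definition rate_coefficients (R : realType) (a : nat -> nat -> R) : Prop :=
  forall j k, (0 < j)%N -> (0 < k)%N -> a j k = a k j /\ 0 <= a j k.

Definition RBK_gain (R : realType) (a : nat -> nat -> R) (x : nat -> R)
    (j : nat) : \bar R :=
  (\sum_(1 <= k <oo) (a (j + k)%N k * x (j + k)%N * x k)%:E)%E.

Definition RBK_loss (R : realType) (a : nat -> nat -> R) (x : nat -> R)
    (j : nat) : \bar R :=
  (\sum_(1 <= k <oo) (a j k * x j * x k)%:E)%E.

(* Only the restriction of c to [t0, +oo[ matters. In the integral equation the
   left-hand side is finite and oo - oo = -oo in \bar R, so the equation forces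
   the positive and negative parts of the integrand to have finite integrals. *)
Record RBK_solution (R : realType) (a : nat -> nat -> R) (t0 : R)
    (c0 : nat -> R) (c : R -> nat -> R) : Prop := {
  RBK_init_X1pos : X1pos c0 ;
  RBK_init : forall j, (0 < j)%N -> c t0 j = c0 j ;
  RBK_X1pos : forall t, t0 <= t -> X1pos (c t) ;
  RBK_continuous : forall j, (0 < j)%N ->
    {within `[t0, +oo[, continuous (fun t => c t j)} ;
  RBK_bounded : (ereal_sup [set norm1 (c t) | t in `[t0, +oo[] < +oo)%E ;
  RBK_integrable : forall j t, (0 < j)%N -> t0 <= t ->
    (\int[lebesgue_measure]_(s in `[t0, t])
       \sum_(1 <= k <oo) (a j k * c s k)%:E < +oo)%E ;
  RBK_integral_eq : forall j t, (0 < j)%N -> t0 <= t ->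
    (c t j)%:E = ((c0 j)%:E + \int[lebesgue_measure]_(s in `[t0, t])
       (RBK_gain a (c s) j - RBK_loss a (c s) j))%E }.

(* Main.v *)
Require Import Defs.
From HB Require Import structures.
From mathcomp Require Import all_boot all_order all_algebra.
From mathcomp Require Import all_classical all_reals all_analysis.
From mathcomp Require Import measurable_realfun ring lra.
Import Order.TTheory GRing.Theory Num.Theory.
Import numFieldNormedType.Exports.

Local Open Scope classical_set_scope.
Local Open Scope ring_scope.

(* Each collision of two clusters destroys at least one of them. Summed over [j],
   the equations therefore show that the number of clusters [\sum_j c j] decreases
   at a rate at least [\sum_j a j j * c j ^+ 2], whose time integral is bounded by
   the initial number of clusters. As the increments of [c j] are at most linear,
   with rate [K * M ^+ 2] where [M] bounds [norm1 (c t)], every large value of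
   [c j] persists over a preceding time interval of fixed length, so [c j] tends
   to [0]. *)

(** * Series of nonnegative terms *)

Lemma nneseries_from1 (R : realType) (f : nat -> \bar R)
    (f0 : forall k, (0 <= f k.+1)%E) :
  (\sum_(1 <= k <oo) f k = \sum_(k <oo) f k.+1)%E.
Proof.
(* The sign of [f 0] is unknown, so it is replaced by [0] before index-shift lemmas for nonnegative
   series are applied. *)
pose g k : \bar R := if k is k'.+1 then f k'.+1 else 0%E.
have g0 k : (0 <= g k)%E by case: k => //=.
transitivity (\sum_(1 <= k <oo) g k)%E.
  apply/congr_lim/funext => n; rewrite big_nat_cond [RHS]big_nat_cond.
  by apply: eq_bigr => -[|k].
rewrite -nneseries_addn//.
by apply: eq_eseriesr => k _; rewrite addn1.
Qed.

(* [(i + k.+1, k)] runs through the pairs strictly below the diagonal. *)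
Lemma nneseries_below_diag (R : realType) (f : nat -> nat -> \bar R)
    (f0 : forall i k, (0 <= f i k)%E) (fC : forall i k, f i k = f k i) :
  (\sum_(i <oo) \sum_(k <oo) f (i + k.+1)%N k + \sum_(i <oo) f i i
   <= \sum_(i <oo) \sum_(k <oo) f i k)%E.
Proof.
(* After the interchange, the inner sum for fixed [k] is the part of column [k] below the diagonal;
   by symmetry it is the part of row [k] beyond [f k k]. *)
rewrite (@nneseries_interchange _ (fun i k => f (i + k.+1)%N k) xpredT xpredT)//.
rewrite -nneseriesD//; last by move=> *; exact: nneseries_ge0.
apply: lee_nneseries => [i _ _|k _].
  by rewrite adde_ge0//; exact: nneseries_ge0.
rewrite (@nneseries_addn _ (fun i => f i k) k.+1)//.
rewrite (eq_eseriesr (g := f k)); last by move=> i _; exact: fC.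
(* The head of row [k], cut at [k.+1], has [f k k] as its last term. *)
rewrite [leRHS](nneseries_split 0%N k.+1)// add0n addeC leeD2r//.
by rewrite big_nat_recr//= leeDr// sume_ge0.
Qed.

(** * Gain and loss rates of a fixed state *)

Section rates.
Context {R : realType} (a : nat -> nat -> R) (K : R).
Context (ha : rate_coefficients a).
Context (haK : forall j k : nat, (0 < j)%N -> (0 < k)%N ->
  a j k <= K * j%:R * k%:R).
Implicit Type x : nat -> R.

Lemma rate_term_ge0 x j k : X1pos x -> (0 < j)%N -> (0 < k)%N ->
  (0 <= (a j k * x j * x k)%:E)%E.
Proof.
move=> [_ x0] j0 k0; have [_ a0] := ha _ _ j0 k0.
by rewrite lee_fin !mulr_ge0//; exact: x0.
Qed.

Lemma RBK_gainE x j : X1pos x -> (0 < j)%N ->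
  RBK_gain a x j =
  (\sum_(k <oo) (a (j + k.+1)%N k.+1 * x (j + k.+1)%N * x k.+1)%:E)%E.
Proof.
move=> hx j0; apply: nneseries_from1 => k; apply: rate_term_ge0 => //.
by rewrite addnS.
Qed.

Lemma RBK_lossE x j : X1pos x -> (0 < j)%N ->
  RBK_loss a x j = (\sum_(k <oo) (a j k.+1 * x j * x k.+1)%:E)%E.
Proof.
by move=> hx j0; apply: nneseries_from1 => k; exact: rate_term_ge0.
Qed.

Lemma RBK_gain_ge0 x j : X1pos x -> (0 < j)%N -> (0 <= RBK_gain a x j)%E.
Proof.
move=> hx j0; rewrite RBK_gainE//; apply: nneseries_ge0 => k _ _.
by apply: rate_term_ge0 => //; rewrite addnS.
Qed.

Lemma RBK_loss_ge0 x j : X1pos x -> (0 < j)%N -> (0 <= RBK_loss a x j)%E.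
Proof.
move=> hx j0; rewrite RBK_lossE//; apply: nneseries_ge0 => k _ _.
exact: rate_term_ge0.
Qed.

Lemma norm1E x : X1pos x -> norm1 x = (\sum_(k <oo) (k.+1%:R * x k.+1)%:E)%E.
Proof.
move=> [_ x0]; rewrite /norm1 nneseries_from1//.
by apply: eq_eseriesr => k _; rewrite ger0_norm//; exact: x0.
Qed.

Lemma norm1_ge0 x : (0 <= norm1 x)%E.
Proof. by apply: nneseries_ge0 => k _ _; rewrite lee_fin mulr_ge0. Qed.

(** The total loss sums a symmetric array over all pairs of sizes, while the total gain sums it only
    over the pairs [(j + k, k)], strictly below the diagonal. The difference thus contains the whole
    diagonal. *)
Lemma RBK_gain_diag_le_loss x : X1pos x ->
  (\sum_(j <oo) RBK_gain a x j.+1 +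
   \sum_(j <oo) (a j.+1 j.+1 * x j.+1 * x j.+1)%:E
   <= \sum_(j <oo) RBK_loss a x j.+1)%E.
Proof.
move=> hx.
pose f j k := (a j.+1 k.+1 * x j.+1 * x k.+1)%:E.
rewrite (eq_eseriesr (g := fun j => \sum_(k <oo) f (j + k.+1)%N k)%E); last first.
  by move=> j _; rewrite RBK_gainE.
rewrite [leRHS](eq_eseriesr (g := fun j => \sum_(k <oo) f j k)%E); last first.
  by move=> j _; rewrite RBK_lossE.
apply: nneseries_below_diag => i k; first exact: rate_term_ge0.
by rewrite /f; have [-> _] := ha _ _ (ltn0Sn i) (ltn0Sn k); rewrite mulrAC.
Qed.

(** The bound [a j k <= K * j * k] factors the double sum: the inner and the outer series each give
    one factor [norm1 x]. *)
Lemma RBK_total_loss_le x (M : R) : 0 <= K -> X1pos x -> (norm1 x <= M%:E)%E ->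
  (\sum_(j <oo) RBK_loss a x j.+1 <= (K * M ^+ 2)%:E)%E.
Proof.
move=> K0 hx xM; have [_ x0] := hx.
have M0 : 0 <= M by rewrite -lee_fin (le_trans (norm1_ge0 x)).
have nx0 k : (0 <= (k.+1%:R * x k.+1)%:E)%E.
  by rewrite lee_fin mulr_ge0//; exact: x0.
apply: (@le_trans _ _ (\sum_(j <oo) ((K * M)%:E * (j.+1%:R * x j.+1)%:E))%E).
  apply: lee_nneseries => [j _ _|j _]; first exact: RBK_loss_ge0.
  rewrite RBK_lossE//.
  apply: (@le_trans _ _
    (\sum_(k <oo) ((K * (j.+1%:R * x j.+1))%:E * (k.+1%:R * x k.+1)%:E))%E).
    apply: lee_nneseries => [k _ _|k _]; first exact: rate_term_ge0.
    rewrite -EFinM lee_fin.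
    have -> : K * (j.+1%:R * x j.+1) * (k.+1%:R * x k.+1) =
        K * j.+1%:R * k.+1%:R * (x j.+1 * x k.+1) by ring.
    by rewrite -mulrA ler_wpM2r ?haK// mulr_ge0//; exact: x0.
  rewrite nneseriesZl// -norm1E//.
  rewrite -EFinM (mulrAC K M) (EFinM (K * (_ * _)) M); apply: lee_wpmul2l => //.
  by rewrite lee_fin mulr_ge0// -lee_fin.
rewrite nneseriesZl// -norm1E//.
by rewrite expr2 mulrA (EFinM (K * M) M); apply: lee_wpmul2l;
  rewrite ?lee_fin ?mulr_ge0.
Qed.

End rates.

(** * A criterion for decay at infinity, and elementary bounds *)

(** A Barbalat-type argument with only a one-sided bound: since [u] cannot rise fast, a value [e] at
    time [t'] keeps [u] above [e / 2] just before [t']. Infinitely many such values would make the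
    integral of [u ^+ 2] unbounded. *)
Lemma cvg0_square_integrable (R : realType) (u : R -> R) (t0 C B : R)
    (mf_u : forall t, measurable_fun `[t0, t] u)
    (C0 : 0 < C) (u0 : forall t, t0 <= t -> 0 <= u t)
    (uC : forall s t, t0 <= s -> s <= t -> u t - u s <= C * (t - s))
    (uB : forall t, t0 <= t ->
      (\int[lebesgue_measure]_(s in `[t0, t]) (u s ^+ 2)%:E <= B%:E)%E) :
  u t @[t --> +oo] --> (0 : R).
Proof.
have mu2 t : measurable_fun `[t0, t] (EFin \o (fun s => u s ^+ 2)).
  by apply/measurable_EFinP; exact: measurable_funX.
apply/cvgr0Pnorm_lt => e e0.
apply: contrapT => far.
have {}far T : exists t, [/\ T < t, t0 <= t & e <= u t].
  apply: contrapT => near_; apply: far.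
  exists (Num.max T t0); split; first exact: num_real.
  move=> t; rewrite /= gt_max => /andP[Tt t0t]; rewrite ger0_norm; last first.
    by apply: u0; exact: ltW.
  rewrite ltNge; apply/negP => eu; apply: near_; exists t; split => //.
  exact: ltW.
(* Chosen so that [C * d = e / 2]: going back by at most [d] from a value [e] leaves at least
   [e / 2]. Then [h] is what such an interval contributes to the integral at least. *)
pose d := e / (2 * C).
have d0 : 0 < d by rewrite divr_gt0// mulr_gt0.
pose h := (e / 2) ^+ 2 * d.
have h0 : 0 < h by rewrite mulr_gt0// exprn_gt0// divr_gt0.
have grow n : exists2 t, t0 <= t &
    ((n%:R * h)%:E <= \int[lebesgue_measure]_(s in `[t0, t]) (u s ^+ 2)%:E)%E.
  elim: n => [|n [t t0t IH]].
    by exists t0 => //; rewrite mul0r integral_ge0// => s _; rewrite lee_fin sqr_ge0.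
  (* Taking [t'] beyond [t + d] puts [[t' - d, t']] to the right of [[t0, t]], so the contributions
     add up. *)
  have [t' [tt' t0t' eu]] := far (t + d).
  exists t' => //.
  pose J := `[t' - d, t']%classic.
  have mJ : measurable J by exact: measurable_itv.
  have tsub : `[t0, t] `|` J `<=` `[t0, t'].
    by move=> s; rewrite /J/= !in_itv/= => -[|] /andP[]; lra.
  apply: (@le_trans _ _
    (\int[lebesgue_measure]_(s in `[t0, t] `|` J) (u s ^+ 2)%:E)%E); last first.
    apply: ge0_subset_integral => //; [exact: measurableU|exact: mu2|].
    by move=> s _; rewrite lee_fin sqr_ge0.
  rewrite ge0_integral_setU//=; last 3 first.
  - by apply: measurable_funS tsub (mu2 t').
  - by move=> s _; rewrite lee_fin sqr_ge0.
  - apply/disj_setPS => s []; rewrite /J/= !in_itv/=; lra.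
  rewrite -natr1 mulrDl mul1r EFinD leeD//.
  apply: (@le_trans _ _
    (\int[lebesgue_measure]_(s in J) (cst ((e / 2) ^+ 2)%:E s))%E).
    rewrite integral_cst//= /J lebesgue_measure_itv/= lte_fin gtrBl d0.
    by rewrite -EFinB -EFinM lee_fin opprB addrC subrK.
  apply: ge0_le_integral => //.
  - by move=> s _; rewrite lee_fin sqr_ge0.
  - by apply: (measurable_funS _ _ (mu2 t')) => // s sJ; apply: tsub; right.
  move=> s; rewrite /J/= in_itv/= => /andP[ds st'].
  rewrite lee_fin; apply: lerXn2r; rewrite ?nnegrE.
  - by rewrite divr_ge0// ltW.
  - by apply: u0; lra.
  have Cd : C * d = e / 2 by rewrite /d; field; rewrite gt_eqF.
  have := @uC s t' ltac:(lra) st'.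
  have : C * (t' - s) <= C * d by rewrite ler_pM2l//; lra.
  lra.
(* By the Archimedean property this many intervals contribute more than [B]. *)
have [t t0t] := grow (Num.bound `|B / h|); rewrite leNgt => /negP; apply.
apply: le_lt_trans (uB t t0t) _.
rewrite lte_fin -ltr_pdivrMr//.
by rewrite (le_lt_trans (ler_norm _))// archi_boundP.
Qed.

Lemma nneseries_ge_term (R : realType) (f : nat -> \bar R) n
    (f0 : forall k, (0 <= f k)%E) : (f n <= \sum_(k <oo) f k)%E.
Proof. by rewrite (@nneseriesD1 _ f n xpredT)// leeDl//; exact: nneseries_ge0. Qed.

Lemma ge0_integral_le_cst (R : realType) (A : set R) (f : R -> \bar R) (C : R)
    (mA : measurable A) (mf : measurable_fun A f)
    (f0 : forall x, A x -> (0 <= f x)%E)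
    (fC : forall x, A x -> (f x <= C%:E)%E) :
  (\int[lebesgue_measure]_(x in A) f x <= C%:E * lebesgue_measure A)%E.
Proof.
by rewrite -integral_cst//; exact: ge0_le_integral.
Qed.

(** * A priori bound and measurability in time of a solution *)

Section solutions.
Context {R : realType} (a : nat -> nat -> R) (K t0 : R) (c0 : nat -> R)
  (c : R -> nat -> R).
Context (ha : rate_coefficients a) (K0 : 0 <= K).
Context (haK : forall j k : nat, (0 < j)%N -> (0 < k)%N ->
  a j k <= K * j%:R * k%:R).
Context (hc : RBK_solution a t0 c0 c).
Local Notation mu := (@lebesgue_measure R).

Lemma RBK_norm1_bound :
  exists2 M : R, 0 <= M & forall t, t0 <= t -> (norm1 (c t) <= M%:E)%E.
Proof.
have := RBK_bounded hc; set S := ereal_sup _ => Soo.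
have leS t : t0 <= t -> (norm1 (c t) <= S)%E.
  move=> t0t; apply: ereal_sup_ubound; exists t => //.
  by rewrite /= in_itv/= t0t.
have S0 : (0 <= S)%E by apply: le_trans (leS t0 (lexx _)); exact: norm1_ge0.
exists (fine S); first exact: fine_ge0.
by rewrite fineK// ge0_fin_numE.
Qed.

Lemma RBK_X1pos_itv t s : `[t0, t]%classic s -> X1pos (c s).
Proof. by rewrite /= in_itv/= => /andP[t0s _]; exact: (RBK_X1pos hc). Qed.

Lemma RBK_measurable j t : (0 < j)%N ->
  measurable_fun `[t0, t] (fun s => c s j).
Proof.
move=> j0; apply: (@measurable_funS _ _ _ _ `[t0, +oo[) => //.
  by move=> s /=; rewrite !in_itv/= => /andP[->].
apply: subspace_continuous_measurable_fun => //.
exact: (RBK_continuous hc).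
Qed.

Lemma RBK_gain_measurable j t : (0 < j)%N ->
  measurable_fun `[t0, t] (fun s => RBK_gain a (c s) j).
Proof.
move=> j0; apply: (eq_measurable_fun (fun s =>
  \sum_(k <oo | k \in xpredT)
    (a (j + k.+1)%N k.+1 * c s (j + k.+1)%N * c s k.+1)%:E)%E).
  by move=> s /set_mem /RBK_X1pos_itv hs; rewrite RBK_gainE.
apply: ge0_emeasurable_sum => [k s /RBK_X1pos_itv hs _|k _].
  by apply: rate_term_ge0 => //; rewrite addnS.
apply/measurable_EFinP; apply: measurable_funM; last exact: RBK_measurable.
by apply: measurable_funM => //; apply: RBK_measurable; rewrite addnS.
Qed.

Lemma RBK_loss_measurable j t : (0 < j)%N ->
  measurable_fun `[t0, t] (fun s => RBK_loss a (c s) j).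
Proof.
move=> j0; apply: (eq_measurable_fun (fun s =>
  \sum_(k <oo | k \in xpredT) (a j k.+1 * c s j * c s k.+1)%:E)%E).
  by move=> s /set_mem /RBK_X1pos_itv hs; rewrite RBK_lossE.
apply: ge0_emeasurable_sum => [k s /RBK_X1pos_itv hs _|k _].
  exact: rate_term_ge0.
apply/measurable_EFinP; apply: measurable_funM; last exact: RBK_measurable.
by apply: measurable_funM => //; exact: RBK_measurable.
Qed.

Lemma RBK_total_gain_measurable t :
  measurable_fun `[t0, t] (fun s => \sum_(j <oo) RBK_gain a (c s) j.+1)%E.
Proof.
apply: (ge0_emeasurable_sum (P := xpredT)) => [j s /RBK_X1pos_itv hs _|j _].
  exact: RBK_gain_ge0.
exact: RBK_gain_measurable.
Qed.

Lemma RBK_total_loss_measurable t :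
  measurable_fun `[t0, t] (fun s => \sum_(j <oo) RBK_loss a (c s) j.+1)%E.
Proof.
apply: (ge0_emeasurable_sum (P := xpredT)) => [j s /RBK_X1pos_itv hs _|j _].
  exact: RBK_loss_ge0.
exact: RBK_loss_measurable.
Qed.

Lemma RBK_diag_measurable t : measurable_fun `[t0, t]
  (fun s => \sum_(j <oo) (a j.+1 j.+1 * c s j.+1 * c s j.+1)%:E)%E.
Proof.
apply: (ge0_emeasurable_sum (P := xpredT)) => [j s /RBK_X1pos_itv cs _|j _].
  exact: rate_term_ge0.
apply/measurable_EFinP; apply: measurable_funM; last exact: RBK_measurable.
by apply: measurable_funM => //; exact: RBK_measurable.
Qed.

(** * Uniform rate bounds, integrability and the balance equation *)

Lemma RBK_rate_bound : exists2 C : R, 0 < C & forall t, t0 <= t ->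
  (\sum_(j <oo) RBK_loss a (c t) j.+1 <= C%:E)%E /\
  (\sum_(j <oo) RBK_gain a (c t) j.+1 <= C%:E)%E.
Proof.
have [M M0 cM] := RBK_norm1_bound.
(* The summand [1] keeps the constant positive when [K * M ^+ 2] vanishes. *)
exists (K * M ^+ 2 + 1); first by rewrite ltr_pwDr// mulr_ge0// exprn_ge0.
move=> t t0t; have ct := RBK_X1pos hc t0t.
have lC : (\sum_(j <oo) RBK_loss a (c t) j.+1 <= (K * M ^+ 2 + 1)%:E)%E.
  apply: (le_trans (RBK_total_loss_le _ _ ha haK _ _ K0 ct (cM t t0t))) => //.
  by rewrite lee_fin lerDl.
split=> //; apply: le_trans lC.
(* The diagonal is nonnegative, so the total gain is below the total loss and inherits its bound. *)
apply: le_trans (RBK_gain_diag_le_loss _ ha _ ct) => //.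
by rewrite leeDl// nneseries_ge0// => k _ _; exact: rate_term_ge0.
Qed.

Lemma RBK_gain_le C t j : (0 < j)%N -> X1pos (c t) ->
  (\sum_(j <oo) RBK_gain a (c t) j.+1 <= C)%E -> (RBK_gain a (c t) j <= C)%E.
Proof.
case: j => // j _ ct; apply: le_trans.
apply: (@nneseries_ge_term _ (fun j => RBK_gain a (c t) j.+1)) => k.
exact: RBK_gain_ge0.
Qed.

Lemma RBK_loss_le C t j : (0 < j)%N -> X1pos (c t) ->
  (\sum_(j <oo) RBK_loss a (c t) j.+1 <= C)%E -> (RBK_loss a (c t) j <= C)%E.
Proof.
case: j => // j _ ct; apply: le_trans.
apply: (@nneseries_ge_term _ (fun j => RBK_loss a (c t) j.+1)) => k.
exact: RBK_loss_ge0.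
Qed.

Lemma bounded_integrable_itv (f : R -> \bar R) (C t : R) :
  measurable_fun `[t0, t] f ->
  (forall s, `[t0, t]%classic s -> (0 <= f s)%E) ->
  (forall s, `[t0, t]%classic s -> (f s <= C%:E)%E) ->
  mu.-integrable `[t0, t] f.
Proof.
move=> mf f0 fC; apply/integrableP; split => //.
under eq_integral => s /set_mem st do rewrite gee0_abs ?f0//.
apply: (@le_lt_trans _ _ (C%:E * mu `[t0, t]%classic)%E).
  exact: ge0_integral_le_cst.
(* The second case is [t <= t0], where the interval has measure zero. *)
by rewrite lebesgue_measure_itv/=; case: ifP => _;
  rewrite ?mule0 -?EFinD -?EFinM ltry.
Qed.

Lemma RBK_gain_integrable j t : (0 < j)%N ->
  mu.-integrable `[t0, t] (fun s => RBK_gain a (c s) j).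
Proof.
move=> j0; have [C _ hC] := RBK_rate_bound.
apply: (@bounded_integrable_itv _ C); first exact: RBK_gain_measurable.
  by move=> s /RBK_X1pos_itv cs; exact: RBK_gain_ge0.
move=> s st; apply: RBK_gain_le => //; first exact: RBK_X1pos_itv st.
by move: st; rewrite /= in_itv/= => /andP[/hC[]].
Qed.

Lemma RBK_loss_integrable j t : (0 < j)%N ->
  mu.-integrable `[t0, t] (fun s => RBK_loss a (c s) j).
Proof.
move=> j0; have [C _ hC] := RBK_rate_bound.
apply: (@bounded_integrable_itv _ C); first exact: RBK_loss_measurable.
  by move=> s /RBK_X1pos_itv cs; exact: RBK_loss_ge0.
move=> s st; apply: RBK_loss_le => //; first exact: RBK_X1pos_itv st.
by move: st; rewrite /= in_itv/= => /andP[/hC[]].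
Qed.

(** Both integrals are finite, so the integral of the difference splits. With the loss moved to the
    left, all terms are nonnegative and the identity can be summed over [j] in [\bar R]. *)
Lemma RBK_balance j t : (0 < j)%N -> t0 <= t ->
  ((c t j)%:E + \int[mu]_(s in `[t0, t]) RBK_loss a (c s) j =
   (c0 j)%:E + \int[mu]_(s in `[t0, t]) RBK_gain a (c s) j)%E.
Proof.
move=> j0 t0t; have ig := RBK_gain_integrable j t j0.
have il := RBK_loss_integrable j t j0.
have := RBK_integral_eq hc j0 t0t.
rewrite (integralB _ ig il)// => ->.
by rewrite -addeA subeK//; exact: integrable_fin_num.
Qed.

(** * One-sided growth bound and decrease of the number of clusters *)

(** Compare the balances at [s] and [t]: the loss can only lower [c j], and the gain rate is at most
    the total gain rate, hence at most [C]. *)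
Lemma RBK_increment_le : exists2 C : R, 0 < C & forall j s t,
  (0 < j)%N -> t0 <= s -> s <= t -> c t j - c s j <= C * (t - s).
Proof.
have [C C0 hC] := RBK_rate_bound; exists C => // j s t j0 t0s st.
have t0t := le_trans t0s st.
have Bs := RBK_balance j s j0 t0s; have Bt := RBK_balance j t j0 t0t.
have sub : `[t0, s] `<=` `[t0, t].
  by move=> x /=; rewrite !in_itv/= => /andP[->] /le_trans ->.
have sub' : `]s, t] `<=` `[t0, t].
  by move=> x /=; rewrite !in_itv/= => /andP[sx ->];
    rewrite (le_trans t0s (ltW sx)).
have itvU : `[t0, t]%classic = `[t0, s] `|` `]s, t].
  by rewrite (@itv_bndbnd_setU _ _ _ (BRight s)) ?bnd_simp.
have Lst : (\int[mu]_(x in `[t0, s]) RBK_loss a (c x) j <=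
            \int[mu]_(x in `[t0, t]) RBK_loss a (c x) j)%E.
  apply: ge0_subset_integral => //; first exact: RBK_loss_measurable.
  by move=> x /RBK_X1pos_itv cx; exact: RBK_loss_ge0.
have Gst : (\int[mu]_(x in `[t0, t]) RBK_gain a (c x) j <=
            \int[mu]_(x in `[t0, s]) RBK_gain a (c x) j + (C * (t - s))%:E)%E.
  rewrite itvU ge0_integral_setU//=.
  - rewrite leeD2l//.
    apply: (le_trans (@ge0_integral_le_cst _ _ _ C _ _ _ _)) => //.
    + exact: measurable_funS (RBK_gain_measurable j t j0).
    + by move=> x /sub' /RBK_X1pos_itv cx; exact: RBK_gain_ge0.
    + move=> x /sub' xt; apply: RBK_gain_le => //; first exact: RBK_X1pos_itv xt.
      by move: xt; rewrite /= in_itv/= => /andP[/hC[]].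
    rewrite lebesgue_measure_itv/= lte_fin; case: ifPn => _.
      by rewrite -EFinB -EFinM.
    by rewrite mule0 lee_fin mulr_ge0 ?subr_ge0// ltW.
  - rewrite -itvU; exact: RBK_gain_measurable.
  - by move=> x [/sub|/sub'] /RBK_X1pos_itv cx; exact: RBK_gain_ge0.
  - by apply/disj_setPS => x [] /=; rewrite !in_itv/=; lra.
move: Bs Bt Lst Gst.
(* Finiteness lets the four integrals be replaced by real numbers, which reduces the claim to linear
   arithmetic. *)
have fing x : (\int[mu]_(x in `[t0, x]) RBK_gain a (c x) j)%E \is a fin_num.
  by apply: integrable_fin_num => //; exact: RBK_gain_integrable.
have finl x : (\int[mu]_(x in `[t0, x]) RBK_loss a (c x) j)%E \is a fin_num.
  by apply: integrable_fin_num => //; exact: RBK_loss_integrable.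
move: (fineK (fing s)) (fineK (fing t)) (fineK (finl s)) (fineK (finl t)).
move: (fine _) (fine _) (fine _) (fine _) => gs gt ls lt <- <- <- <-.
rewrite -!EFinD !lee_fin => -[Bs] [Bt] Lst' Gst'.
move: Bs Bt Lst' Gst'; clear; lra.
Qed.

(** The number of clusters is never differentiated: the integrated balances are summed over [j],
    with series and integral exchanged by nonnegativity, and compared with the integral of
    [RBK_gain_diag_le_loss]. *)
Lemma RBK_integral_diag_le t : t0 <= t ->
  (\int[mu]_(s in `[t0, t])
     \sum_(j <oo) (a j.+1 j.+1 * c s j.+1 * c s j.+1)%:E <= norm1 c0)%E.
Proof.
move=> t0t; have [C C0 hC] := RBK_rate_bound.
have ct := RBK_X1pos hc t0t; have c0X := RBK_init_X1pos hc.
set G := (fun s => \sum_(j <oo) RBK_gain a (c s) j.+1)%E.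
set L := (fun s => \sum_(j <oo) RBK_loss a (c s) j.+1)%E.
set A := (fun s => \sum_(j <oo) _)%E.
have G0 s : `[t0, t]%classic s -> (0 <= G s)%E.
  by move=> /RBK_X1pos_itv cs; apply: nneseries_ge0 => *; exact: RBK_gain_ge0.
have A0 s : `[t0, t]%classic s -> (0 <= A s)%E.
  by move=> /RBK_X1pos_itv cs; apply: nneseries_ge0 => *; exact: rate_term_ge0.
have mG : measurable_fun `[t0, t] G by exact: RBK_total_gain_measurable.
have mL : measurable_fun `[t0, t] L by exact: RBK_total_loss_measurable.
have mA : measurable_fun `[t0, t] A by exact: RBK_diag_measurable.
have GA : (\int[mu]_(s in `[t0, t]) G s + \int[mu]_(s in `[t0, t]) A s <=
           \int[mu]_(s in `[t0, t]) L s)%E.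
  rewrite -ge0_integralD//; apply: ge0_le_integral => //.
  - by move=> s st; rewrite adde_ge0 ?G0 ?A0.
  - by apply: emeasurable_funD.
  - by move=> s /RBK_X1pos_itv cs; exact: RBK_gain_diag_le_loss.
have bal : (\sum_(j <oo) (c t j.+1)%:E + \int[mu]_(s in `[t0, t]) L s =
            \sum_(j <oo) (c0 j.+1)%:E + \int[mu]_(s in `[t0, t]) G s)%E.
  have iG : (\int[mu]_(s in `[t0, t]) G s =
      \sum_(j <oo) \int[mu]_(s in `[t0, t]) RBK_gain a (c s) j.+1)%E.
    apply: (@integral_nneseries _ _ _ mu _ _ (fun j s => RBK_gain a (c s) j.+1)).
    - exact: measurable_itv.
    - by move=> j; exact: RBK_gain_measurable.
    - by move=> j s /RBK_X1pos_itv cs; exact: RBK_gain_ge0.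
  have iL : (\int[mu]_(s in `[t0, t]) L s =
      \sum_(j <oo) \int[mu]_(s in `[t0, t]) RBK_loss a (c s) j.+1)%E.
    apply: (@integral_nneseries _ _ _ mu _ _ (fun j s => RBK_loss a (c s) j.+1)).
    - exact: measurable_itv.
    - by move=> j; exact: RBK_loss_measurable.
    - by move=> j s /RBK_X1pos_itv cs; exact: RBK_loss_ge0.
  rewrite iG iL -!nneseriesD.
  - by apply: eq_eseriesr => j _; exact: RBK_balance.
  - by move=> j _ _; rewrite lee_fin; exact: c0X.2.
  - move=> j _ _; apply: integral_ge0 => s /RBK_X1pos_itv cs.
    exact: RBK_gain_ge0.
  - by move=> j _ _; rewrite lee_fin; exact: ct.2.
  - move=> j _ _; apply: integral_ge0 => s /RBK_X1pos_itv cs.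
    exact: RBK_loss_ge0.
have Gint : mu.-integrable `[t0, t] G.
  apply: (@bounded_integrable_itv _ C _ mG G0) => s.
  by rewrite /= in_itv/= => /andP[/hC[]].
(* Finiteness of this integral is what allows it to be cancelled at the end. *)
have Gfin : (\int[mu]_(s in `[t0, t]) G s)%E \is a fin_num.
  exact: (@integrable_fin_num _ _ _ mu _ (measurable_itv _) G Gint).
clear Gint hC mG mL mA; clearbody G L A.
apply: (@le_trans _ _ (\sum_(j <oo) (c0 j.+1)%:E)%E); last first.
  (* Every size is at least one, so the number of clusters is at most the mass. *)
  rewrite (norm1E _ c0X); apply: lee_nneseries => j _.
    by move=> _; rewrite lee_fin; exact: c0X.2.
  by rewrite lee_fin ler_peMl ?ler1n//; exact: c0X.2.
(* After adding the integral of [G] to both sides, [bal] turns the right side into the clusters at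
   [t] plus the integral of [L], and [GA] concludes. *)
rewrite -(leeD2rE _ _ Gfin) -bal addeC (le_trans GA)// leeDr//.
by apply: nneseries_ge0 => j _ _; rewrite lee_fin; exact: ct.2.
Qed.

End solutions.

(** * Decay of each concentration *)

Theorem proposition8p1 (R : realType) (a : nat -> nat -> R) (K t0 : R)
    (c0 : nat -> R) (c : R -> nat -> R)
    (ha : rate_coefficients a)
    (hK : 0 < K)
    (haK : forall j k : nat, (0 < j)%N -> (0 < k)%N ->
       a j k <= K * j%:R * k%:R)
    (haj : forall j : nat, (0 < j)%N -> 0 < a j j)
    (hc : RBK_solution a t0 c0 c) :
  forall j : nat, (0 < j)%N -> c t j @[t --> +oo] --> (0 : R).
Proof.
move=> j j0.
have [C C0 hC] := RBK_increment_le a K t0 c0 c ha (ltW hK) haK hc.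
have c0X := RBK_init_X1pos hc.
have ajj := haj j j0.
(* The bound keeps only the [j]-th term of the diagonal series, whose integral is at most
   [norm1 c0]; dividing by [a j j] uses its positivity. *)
apply: (@cvg0_square_integrable _ _ t0 C (fine (norm1 c0) / a j j)) => //.
- by move=> t; exact: (RBK_measurable _ _ _ _ hc).
- by move=> t /(RBK_X1pos hc)[_]; exact.
- by move=> s t; exact: hC.
move=> t t0t; rewrite mulrC EFinM fineK; last first.
  by rewrite ge0_fin_numE ?norm1_ge0//; exact: c0X.1.
rewrite -(@lee_pmul2l _ (a j j)%:E)// muleA -EFinM divff ?gt_eqF// mul1e.
apply: le_trans (RBK_integral_diag_le _ _ _ _ _ ha (ltW hK) haK hc _ t0t).
have mc2 : measurable_fun `[t0, t] (EFin \o (fun s => c s j ^+ 2)).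
  apply/measurable_EFinP; apply: measurable_funX.
  exact: (RBK_measurable _ _ _ _ hc).
rewrite -ge0_integralZl_EFin.
- apply: ge0_le_integral.
  + exact: measurable_itv.
  + by move=> s _; rewrite -EFinM lee_fin mulr_ge0 ?sqr_ge0// ltW.
  + apply/measurable_EFinP; apply: measurable_funM => //.
    exact/measurable_EFinP.
  + exact: (RBK_diag_measurable _ _ _ _ ha hc).
  move=> s /(RBK_X1pos_itv _ _ _ _ hc) cs.
  case: j j0 {ajj mc2} => // j _; rewrite -EFinM expr2 mulrA.
  apply: (@nneseries_ge_term _
    (fun j => (a j.+1 j.+1 * c s j.+1 * c s j.+1)%:E)) => k.
  exact: rate_term_ge0.
- exact: measurable_itv.
- by move=> s _; rewrite lee_fin sqr_ge0.
- exact: mc2.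
- exact: ltW.
Qed.
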